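(* Let $K=\mathbb{F}_q$ be a finite field, let $S=K[t_1,\ldots,t_s]$, and let $I=I(T)$ be the vanishing ideal of the affine torus $T=(\mathbb{F}_q^* )^s$. If $q\geq 3$ and $\prec$ is a graded monomial order on $S$, then $$ \delta_r(\mathcal{C}_{\leq d})=|T|-\max\{\deg(S/(I,F))\mid F\in\mathcal{H}_{\prec,d,r}\}\quad\mbox{for } d\geq 1\mbox{ and }1\leq r\leq\dim_K(\mathcal{C}_{\leq d}). $$
   Context: $I(T)$ is the set of all $f\in S$ vanishing at every point of $T$. A monomial order is graded if monomials are first compared by total degree; ${\rm in}_\prec(f)$ is the initial monomial of a nonzero $f\in S$; monic means the leading coefficient with respect to $\prec$ is $1$. Let $V_{\leq d}$ be the set of all squarefree monomials of $S$ of degree at most $d$ (including $1$), and $KV_{\leq d}$ its $K$-span. Write $T=\{P_1,\ldots,P_m\}$. The squarefree evaluation code $\mathcal{C}_{\leq d}\subset K^m$ of degree $d$ on $T$ is the image of $KV_{\leq d}\to K^m$, $f\mapsto(f(P_1),\ldots,f(P_m))$. $\mathcal{H}_{\prec,d,r}$ is the set of all $F=\{f_1,\ldots,f_r\}\subset KV_{\leq d}\setminus\{0\}$ such that ${\rm in}_\prec(f_1),\ldots,{\rm in}_\prec(f_r)$ are distinct monomials and each $f_i$ is monic. $(I,F)$ is the ideal generated by $I\cup F$. For an ideal $J\subset S$, let $H_J^a(d)=\dim_K(S_{\leq d}/J_{\leq d})$, where $S_{\leq d}$, $J_{\leq d}$ are the polynomials of degree at most $d$ in $S$, $J$. If $J\subsetneq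 S$ and $k=\dim(S/J)$ (Krull dimension), then for $d\gg0$ $H_J^a(d)$ is a polynomial in $d$ of degree $k$ with leading coefficient $a_k$, and $\deg(S/J)=k!\,a_k$; $\deg(S/J)=0$ if $J=S$. In particular, if $k=0$, then $\deg(S/J)=\dim_K(S/J)$. For a linear code $C\subset K^m$ and $1\leq r\leq\dim_K C$, $\delta_r(C)=\min\{|\chi(D)| : D \text{ a linear subspace of } C,\ \dim_K D=r\}$, where $\chi(D)=\{i : \exists\,(a_1,\ldots,a_m)\in D,\ a_i\neq 0\}$. *)

(* Defs.v *)
From HB Require Import structures.
From mathcomp Require Import all_boot all_order all_algebra.
From mathcomp Require Import boolp classical_sets.
From mathcomp.multinomials Require Import mpoly.

Set Implicit Arguments.
Unset Strict Implicit.
Unset Printing Implicit Defensive.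

Import Order.TTheory GRing.Theory Num.Theory.
Local Open Scope classical_set_scope.
Local Open Scope ring_scope.

Definition is_max {disp} {R : porderType disp} (A : set R) (x : R) : Prop :=
  A x /\ ubound A x.

Definition is_min {disp} {R : porderType disp} (A : set R) (x : R) : Prop :=
  A x /\ lbound A x.

(* The value 0 when A is empty is a dummy; see ghwP below. *)
Definition nat_min (A : set nat) : nat := xget 0%N (is_min A).

Lemma nat_minP (A : set nat) : A !=set0 -> is_min A (nat_min A).
Proof.
case=> n An; have exA : exists k, `[< A k >] by exists n; apply/asboolP.
apply: (@xgetPex _ 0%N (is_min A)); exists (ex_minn exA).
case: ex_minnP => k /asboolP Ak kP; split=> // j Aj.
exact/kP/asboolP.
Qed.

Section MonomialOrders.

Variables (n : nat) (le : rel 'X_{1..n}).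

Definition monomial_order : Prop :=
  [/\ reflexive le, antisymmetric le, transitive le & total le] /\
  [/\ forall m, le 0%MM m
    & forall m1 m2 p, le m1 m2 -> le (m1 + p)%MM (m2 + p)%MM].

Definition graded_monomial_order : Prop :=
  monomial_order /\
  (forall m1 m2, (mdeg m1 < mdeg m2)%N -> le m1 m2 /\ m1 <> m2).

(* The largest monomial of f for the order le (multinomials' mlead is tied to
   degrevlex); f is assumed nonzero. *)
Definition inm (K : fieldType) (f : {mpoly K[n]}) : 'X_{1..n} :=
  last 0%MM (sort le (msupp f)).

Definition monic_for (K : fieldType) (f : {mpoly K[n]}) : Prop :=
  f@_(inm f) = 1.

End MonomialOrders.

Section Degree.

Variables (K : fieldType) (n : nat).
Local Notation S := {mpoly K[n]}.

Definition ideal_gen (G : set S) : set S :=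
  [set f | exists (k : nat) (c g : 'I_k -> S),
    (forall i, G (g i)) /\ f = \sum_(i < k) c i * g i].

(* idealr_closed includes properness. *)
Definition prime_ideal (P : set S) : Prop :=
  idealr_closed [pred f | f \in P] /\ prime_idealr_closed [pred f | f \in P].

Definition prime_chain (J : set S) (k : nat) (P : nat -> set S) : Prop :=
  (forall i, (i <= k)%N -> prime_ideal (P i) /\ J `<=` P i) /\
  (forall i, (i < k)%N -> P i `<` P i.+1).

(* k is the Krull dimension of S/J: primes of S/J are primes of S above J. *)
Definition is_krull_dim (J : set S) (k : nat) : Prop :=
  is_max [set l : nat | exists P, prime_chain J l P] k.

(* msize f is 1 + the degree of f, and msize 0 = 0. *)
Definition poly_le (d : nat) : set S := [set f | (msize f <= d.+1)%N].

(* The classes of some b_0, ..., b_(k-1) in V form a K-basis of V/W. *)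
Definition is_quotient_dim (V W : set S) (k : nat) : Prop :=
  exists b : 'I_k -> S,
    [/\ forall i, V (b i),
        forall c : 'I_k -> K, W (\sum_i c i *: b i) -> forall i, c i = 0
      & forall f, V f -> exists c : 'I_k -> K, W (f - \sum_i c i *: b i)].

Definition affine_hilbert (J : set S) (d : nat) : nat :=
  xget 0%N (is_quotient_dim (poly_le d) (poly_le d `&` J)).

Definition is_degree (J : set S) (e : rat) : Prop :=
  (J = setT /\ e = 0) \/
  (J <> setT /\ exists (k : nat) (p : {poly rat}),
    [/\ is_krull_dim J k,
        size p = k.+1,
        exists d0, forall d, (d0 <= d)%N -> (affine_hilbert J d)%:R = p.[d%:R]
      & e = k`!%:R * lead_coef p]).

(* deg(S/J) *)
Definition degree (J : set S) : rat := xget 0 (is_degree J).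

End Degree.

Section LinearCodes.

Variables (K : finFieldType) (m : nat).

Definition chi (D : {vspace 'rV[K]_m}) : {set 'I_m} :=
  [set i | [exists a : 'rV[K]_m, (a \in D) && (a 0 i != 0)]].

(* The generalized Hamming weight delta_r(C). *)
Definition ghw (C : {vspace 'rV[K]_m}) (r : nat) : nat :=
  nat_min [set w | exists D : {vspace 'rV[K]_m},
                     [/\ (D <= C)%VS, \dim D = r & w = #|chi D|]].

Lemma ghwP (C : {vspace 'rV[K]_m}) (r : nat) : (r <= \dim C)%N ->
  is_min [set w | exists D : {vspace 'rV[K]_m},
                    [/\ (D <= C)%VS, \dim D = r & w = #|chi D|]] (ghw C r).
Proof.
move=> rC; apply: nat_minP; pose X := take r (vbasis C).
exists #|chi <<X>>|, <<X>>%VS; split=> //.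
  by apply/span_subvP=> x /mem_take; apply: vbasis_mem.
have /eqP-> : free X.
  have := basis_free (vbasisP C).
  by rewrite -{1}(cat_take_drop r (vbasis C)) => /catl_free.
by rewrite size_takel ?size_tuple.
Qed.

End LinearCodes.

Section SquarefreeCodes.

Variables (K : finFieldType) (s : nat).
Local Notation S := {mpoly K[s]}.
Local Notation point := {ffun 'I_s -> K}.

Definition torus : {set point} := [set P : point | [forall i, P i != 0]].

Definition vanishing_ideal (T : {set point}) : set S :=
  [set f | forall P : point, P \in T -> f.@[P] = 0].

(* V_{<= d}; 'X_{1..s < d.+1} is the type of monomials of degree < d.+1. *)
Definition sqfree (d : nat) : {set 'X_{1..s < d.+1}} :=
  [set m : 'X_{1..s < d.+1} | [forall i, m i <= 1]%N].

(* K V_{<= d} *)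
Definition sqfree_span (d : nat) : set S :=
  [set f | exists c : 'X_{1..s < d.+1} -> K,
    f = \sum_(m in sqfree d) c m *: 'X_[m]].

Definition ev (T : {set point}) (f : S) : 'rV[K]_#|T| :=
  \row_(i < #|T|) f.@[(enum_val i : point)].

(* Given as the span of the evaluations of V_{<= d}; by sqfree_codeP below this
   is the image of K V_{<= d} under evaluation. *)
Definition sqfree_code (T : {set point}) (d : nat) : {vspace 'rV[K]_#|T|} :=
  <<[seq ev T 'X_[val m] | m in sqfree d]>>%VS.

Lemma ev_sum (T : {set point}) (d : nat) (c : 'X_{1..s < d.+1} -> K) :
  ev T (\sum_(m in sqfree d) c m *: 'X_[m]) =
  \sum_(m in sqfree d) c m *: ev T 'X_[val m].
Proof.
apply/rowP=> i; rewrite mxE raddf_sum summxE; apply: eq_bigr => m _.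
by rewrite /= mevalZ !mxE.
Qed.

Lemma sqfree_codeP (T : {set point}) (d : nat) :
  [set v | v \in sqfree_code T d] = [set ev T f | f in sqfree_span d].
Proof.
apply/seteqP; split=> v /=; last first.
  case=> f [c ->] <-; rewrite ev_sum; apply: memv_suml => m mV.
  by apply/memvZ/memv_span; apply/fintype.imageP; exists m.
have sub : (sqfree_code T d <= \sum_(m in sqfree d) <[ev T 'X_[val m]]>)%VS.
  apply/span_subvP => _ /fintype.imageP[m mV ->].
  by rewrite (subvP (sumv_sup m mV (subvv _))) ?memv_line.
move=> /(subvP sub)/memv_sumP[w wP ->].
have cP m : exists c, m \in sqfree d -> w m = c *: ev T 'X_[val m].
  case: (boolP (m \in sqfree d)) => mV; last by exists 0.
  by have /vlineP[c ->] := wP m mV; exists c.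
have {cP} [c cP] := choice cP.
exists (\sum_(m in sqfree d) c m *: 'X_[m]); first by exists c.
by rewrite ev_sum; apply: eq_bigr => m /cP.
Qed.

(* H_{<,d,r} *)
Definition Hset (le : rel 'X_{1..s}) (d r : nat) : set (set S) :=
  [set F | exists f : r.-tuple S,
    [/\ F = [set` f],
        forall g, g \in f -> [/\ sqfree_span d g, g <> 0 & monic_for le g]
      & uniq [seq inm le g | g <- f]]].

End SquarefreeCodes.

(* Main.v *)
Require Import Defs.
From mathcomp Require Import all_boot all_order all_algebra.
From mathcomp Require Import boolp classical_sets.
From mathcomp.multinomials Require Import mpoly.

(* Since S/I(T) is the algebra of functions on T, (I, F) is the vanishing ideal
   of the common zeros Z of F in T, and deg(S/(I, F)) = |Z|.  If D is spanned by
   the evaluations of F, then chi(D) is the complement of Z, so it remains to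
   match r-dimensional subcodes with elements of H_{<,d,r}.  Polynomials with
   distinct initial monomials are independent, and evaluation is injective on
   KV_{<= d} because q >= 3; conversely, an r-dimensional space of polynomials
   has at least r initial monomials. *)

Set Implicit Arguments.
Unset Strict Implicit.
Unset Printing Implicit Defensive.

Import Order.TTheory GRing.Theory Num.Theory.
Local Open Scope classical_set_scope.
Local Open Scope ring_scope.

(** * Vanishing ideals of finite point sets: generators and Hilbert function *)

Section VanishingIdeal.

Variables (K : finFieldType) (s : nat).
Local Notation S := {mpoly K[s]}.
Local Notation point := {ffun 'I_s -> K}.
Implicit Types (P Q : point) (T Z : {set point}) (f g : S).

(** The Lagrange interpolation polynomial of [Q] on the finite grid $K^s$. *)
Definition indicator Q : S :=
  \prod_(i < s) \prod_(c | c != Q i) ((Q i - c)^-1 *: ('X_i - c%:MP)).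

Lemma indicatorE Q P : (indicator Q).@[P] = (P == Q)%:R.
Proof.
have factorE i : (\prod_(c | c != Q i) ((Q i - c)^-1 *: ('X_i - c%:MP))).@[P]
                 = (P i == Q i)%:R :> K.
  rewrite rmorph_prod /=; have [PQi|nPQi] := eqVneq (P i) (Q i).
    apply: big1 => c cQ.
    by rewrite mevalZ mevalB mevalXU mevalC PQi mulVf // subr_eq0 eq_sym.
  rewrite (bigD1 (P i)) //= mevalZ mevalB mevalXU mevalC subrr.
  by rewrite mulr0 mul0r.
transitivity (\prod_i (P i == Q i)%:R : K).
  by rewrite /indicator rmorph_prod; apply: eq_bigr => i _; apply: factorE.
have [->|nPQ] := eqVneq P Q; first by apply: big1 => i _; rewrite eqxx.
have [i nPQi] : exists i, P i != Q i.
  apply/existsP; apply: contraR nPQ; rewrite negb_exists => /forallP PQ.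
  by apply/eqP/ffunP => i; apply/eqP; rewrite -[_ == _]negbK.
by rewrite (bigD1 i) //= (negbTE nPQi) mul0r.
Qed.

Lemma meval_sum (I : Type) (r : seq I) (A : pred I) (F : I -> S) P :
  (\sum_(i <- r | A i) F i).@[P] = \sum_(i <- r | A i) (F i).@[P].
Proof. exact: raddf_sum. Qed.

Definition zeros T (F : set S) : {set point} :=
  [set P in T | `[< forall f, F f -> f.@[P] = 0 >]]%SET.

(* Each indicator polynomial of a point of T off the common zeros of F is,
   modulo I(T), a multiple of an element of F. *)
Lemma ideal_gen_vanishing T (F : set S) :
  ideal_gen (vanishing_ideal T `|` F) = vanishing_ideal (zeros T F).
Proof.
apply/seteqP; split => [_ [k [c [g [gG ->]]]] P | g g0].
  rewrite inE => /andP[PT /asboolP PF]; rewrite meval_sum big1 //= => i _.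
  by rewrite mevalM; case: (gG i) => [/(_ P PT)|/PF] gi0; rewrite gi0 mulr0.
(* At a point of [T] where some element of [F] is nonzero, take that element. Elsewhere 0 will do: a
   remaining point of [T] is a common zero, where [g] vanishes. *)
have fP P : exists f, (vanishing_ideal T `|` F) f /\
    (P \in T -> f.@[P] = 0 -> g.@[P] = 0).
  have [PT|_] := boolP (P \in T); last first.
    by exists 0; split=> //; left=> Q _; rewrite meval0.
  have [[f Ff f0]|noF] := pselect (exists2 f, F f & f.@[P] <> 0).
    by exists f; split=> [|_ /f0]; first by right.
  exists 0; split=> [|_ _]; first by left=> Q _; rewrite meval0.
  apply: g0; rewrite inE PT; apply/asboolP => f Ff.
  by apply: contrapT => f0; apply: noF; exists f.
have {fP} [f fP] := choice fP.
(* Interpolation makes the sum of the products [h Q * f Q] agree with [g] on [T], so [g'] lies in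
   $I(T)$. Where [f Q] vanishes at [Q], so does [g], and the term contributes 0. *)
pose h Q : S := (g.@[Q] / (f Q).@[Q]) *: indicator Q.
pose g' := g - \sum_(j < #|T|) h (enum_val j) * f (enum_val j).
(* Index 0 carries [g'] with coefficient 1; the other indices run over the points of [T]. *)
exists #|T|.+1, (fun i => if unlift ord0 i is Some j then h (enum_val j) else 1),
  (fun i => if unlift ord0 i is Some j then f (enum_val j) else g').
split=> [i|].
  case: (unliftP ord0 i) => [j _|_]; first by case: (fP (enum_val j)).
  left=> P PT; rewrite mevalB meval_sum.
  rewrite (bigD1 (enum_rank_in PT P)) //= big1 => [|j].
    rewrite addr0 enum_rankK_in // mevalM mevalZ indicatorE eqxx mulr1.
    have [fP0|fP0] := eqVneq (f P).@[P] 0; last by rewrite divfK ?subrr.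
    by rewrite fP0 mulr0 subr0; case: (fP P) => _; apply.
  rewrite mevalM mevalZ indicatorE => jP; case: eqP => [Pj|_].
    by case/eqP: jP; apply: enum_val_inj; rewrite enum_rankK_in.
  by rewrite mulr0 mul0r.
rewrite big_ord_recl unlift_none mul1r /g'.
by under [X in _ + X]eq_bigr => j _ do rewrite liftK; rewrite subrK.
Qed.

Lemma ev_eq0 Z f : ev Z f = 0 <-> vanishing_ideal Z f.
Proof.
split=> [/rowP f0 P PZ | f0].
  by have := f0 (enum_rank_in PZ P); rewrite !mxE enum_rankK_in.
by apply/rowP => i; rewrite !mxE f0 // enum_valP.
Qed.

Lemma evB Z f g : ev Z (f - g) = ev Z f - ev Z g.
Proof. by apply/rowP => i; rewrite !mxE mevalB. Qed.

Lemma ev_comb Z k (c : 'I_k -> K) (b : 'I_k -> S) :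
  ev Z (\sum_i c i *: b i) = \sum_i c i *: ev Z (b i).
Proof.
apply/rowP => j; rewrite mxE meval_sum summxE.
by apply: eq_bigr => i _; rewrite /= mevalZ !mxE.
Qed.

Lemma ev_comb_mx Z k (c : 'I_k -> K) (b : 'I_k -> S) :
  ev Z (\sum_i c i *: b i) = (\row_i c i) *m \matrix_i ev Z (b i).
Proof.
rewrite ev_comb mulmx_sum_row; apply: eq_bigr => i _.
by rewrite rowK mxE.
Qed.

Lemma poly_le_comb d k (c : 'I_k -> K) (b : 'I_k -> S) :
  (forall i, poly_le d (b i)) -> poly_le d (\sum_i c i *: b i).
Proof.
move=> bd; rewrite /poly_le /=; elim/big_ind: _ => [|f g fd gd|i _].
- by rewrite msize0.
- by rewrite (leq_trans (msizeD_le _ _)) // geq_max fd.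
- exact: leq_trans (msizeZ_le _ _) (bd i).
Qed.

(** Evaluation embeds $S_{\leq d}/I(Z)_{\leq d}$ into $K^{|Z|}$. The bound on [d] puts the
    indicators of [Z] in $S_{\leq d}$, and they map to the standard basis. *)
Lemma affine_hilbert_vanishing Z d :
  (\max_(P in Z) msize (indicator P) <= d.+1)%N ->
  affine_hilbert (vanishing_ideal Z) d = #|Z|.
Proof.
move=> /bigmax_leqP indd; apply: xget_unique => [|k [b [bd bfree bgen]]].
  exists (fun i => indicator (enum_val i)).
  have evind c : ev Z (\sum_(i < #|Z|) c i *: indicator (enum_val i)) = \row_i c i.
    apply/rowP => j; rewrite !mxE meval_sum (bigD1 j) //= big1 => [|i ij].
      by rewrite mevalZ indicatorE eqxx mulr1 addr0.
    by rewrite mevalZ indicatorE (inj_eq enum_val_inj) eq_sym (negbTE ij) mulr0.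
  split=> [i|c [_ /ev_eq0]|f fd].
  - by apply: indd; apply: enum_valP.
  - by rewrite evind => /rowP c0 i; have := c0 i; rewrite !mxE.
  - exists (fun i => f.@[(enum_val i : point)]); split; last first.
      by apply/ev_eq0; rewrite evB evind subrr.
    rewrite /poly_le /= (leq_trans (msizeD_le _ _)) // geq_max fd msizeN.
    by apply: poly_le_comb => i; apply: indd; apply: enum_valP.
(* [affine_hilbert] is an [xget], so any basis [b] must be shown to have size [#|Z|]: independence
   modulo $I(Z)$ makes [A] row free, and generating the indicators makes it row full. *)
pose A := \matrix_i ev Z (b i).
have /eqP <- : row_free A.
  apply: inj_row_free => v vA0; apply/rowP => i; rewrite mxE.
  apply: (bfree (fun i => v 0 i)); split; first exact: poly_le_comb.
  apply/ev_eq0; rewrite ev_comb_mx -[RHS]vA0; congr (_ *m _).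
  by apply/rowP => j; rewrite mxE.
apply/eqP; rewrite -[_ == _]/(row_full A); apply/row_fullP.
have cP (i : 'I_#|Z|) : exists c, ev Z (indicator (enum_val i)) = ev Z (\sum_j c j *: b j).
  have [|c [_ /ev_eq0 c0]] := bgen (indicator (enum_val i)).
    by apply: indd; apply: enum_valP.
  by exists c; apply/eqP; rewrite -subr_eq0 -evB c0.
have {cP} [c cP] := choice cP.
exists (\matrix_(i, j) c i j); apply/row_matrixP => i.
transitivity ((\row_j c i j) *m A); last rewrite -ev_comb_mx -cP.
  by rewrite row_mul; congr (_ *m _); apply/rowP => j; rewrite !mxE.
by apply/rowP => j; rewrite !mxE indicatorE (inj_eq enum_val_inj) eq_sym.
Qed.

(** * Krull dimension and degree of a vanishing ideal *)

Lemma prime_ideal_prod (I : finType) (J : set S) (u : I -> S) :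
  prime_ideal J -> J (\prod_i u i) -> exists i, J (u i).
Proof.
case=> [[_ J1 _] Jprime]; elim/big_rec: _ => [J1'|i x _ IHx Jux].
  by move: J1 => /negP[]; rewrite !inE.
have /orP[] : (u i \in [pred f | f \in J]) || (x \in [pred f | f \in J]).
- by apply: Jprime; rewrite !inE.
- by rewrite !inE => Jui; exists i.
- by rewrite !inE => /IHx.
Qed.

(* For every f, the product of all f - c, c in K, vanishes on all of K^s. *)
Lemma vanishing_prime_maximal Z (J J' : set S) :
  vanishing_ideal Z `<=` J -> prime_ideal J -> prime_ideal J' ->
  ~ (J `<` J').
Proof.
move=> ZJ Jprime [[J'0 J'1 J'D] _]; rewrite properEneq => -[/eqP nJJ' JJ'].
apply: nJJ'; apply/seteqP; split=> // f J'f.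
have /(prime_ideal_prod Jprime)[c Jfc] : J (\prod_(c : K) (f - c%:MP)).
  apply: ZJ => P _; rewrite rmorph_prod (bigD1 f.@[P]) //=.
  by rewrite mevalB mevalC subrr mul0r.
(* If [c] is 0, then [f] is in [J]. Otherwise [J'] contains [f] and [f - c], hence the unit [c], and
   is not proper. *)
have [c0|c0] := eqVneq c 0; first by move: Jfc; rewrite c0 mpolyC0 subr0.
case/negP: J'1; rewrite inE.
have J'c : c%:MP \in [pred g | g \in J'].
  have -> : c%:MP = (-1) * (f - c%:MP) + f by rewrite mulN1r opprB subrK.
  by apply: J'D; rewrite !inE //; apply: JJ'.
have -> : 1 = c^-1%:MP * c%:MP + 0 :> S by rewrite addr0 -mpolyCM mulVf.
by have := J'D c^-1%:MP _ _ J'c J'0; rewrite inE.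
Qed.

Lemma vanishing_ideal_setT Z : vanishing_ideal Z = setT <-> Z = finset.set0.
Proof.
split=> [ZT|->]; last by apply/seteqP; split=> // f _ P; rewrite inE.
apply/eqP/set0Pn => -[P PZ]; have : (setT : set S) 1 by [].
by rewrite -ZT => /(_ P PZ) /eqP; rewrite meval1 oner_eq0.
Qed.

(** The ideal of one point of [Z] is prime and gives a chain of length 0. A longer chain already
    fails at its first inclusion, by [vanishing_prime_maximal]. *)
Lemma vanishing_ideal_krull_dim Z : Z != finset.set0 ->
  is_krull_dim (vanishing_ideal Z) 0.
Proof.
case/set0Pn => P PZ; split=> [|l [C [Cprime Cincr]]].
  exists (fun=> vanishing_ideal [set P]%SET); split=> // i _; split.
    have inJ f : (f \in [pred g | g \in vanishing_ideal [set P]%SET]) =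
                 (f.@[P] == 0).
      rewrite !inE; apply/idP/eqP => [|f0]; rewrite inE; last first.
        by move=> Q; rewrite finset.inE => /eqP ->.
      by apply; rewrite finset.inE.
    split; first split.
    - by rewrite inJ meval0.
    - by rewrite inJ meval1 oner_eq0.
    - move=> a f g; rewrite !inJ => /eqP f0 /eqP g0.
      by rewrite mevalD mevalM f0 g0 mulr0 addr0.
    - by move=> f g; rewrite !inJ mevalM mulf_eq0.
  by move=> f f0 Q; rewrite finset.inE => /eqP ->; apply: f0.
case: l Cprime Cincr => // l Cprime /(_ 0 isT).
have [C0 ZC0] := Cprime 0 isT; have [C1 _] := Cprime 1 isT.
by move/(vanishing_prime_maximal ZC0 C0 C1).
Qed.

Lemma poly_eventually_const (p : {poly rat}) (a : rat) (d0 : nat) :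
  (forall d, (d0 <= d)%N -> a = p.[d%:R]) -> p = a%:P.
Proof.
move=> pa; apply/eqP; rewrite -subr_eq0; apply/eqP.
(* [size q] distinct roots are one more than the degree of a nonzero [q] allows. *)
set q := p - _; pose rs : seq rat := [seq (d0 + i)%:R | i <- iota 0 (size q)].
apply: (@roots_geq_poly_eq0 _ q rs).
- apply/allP => _ /mapP[i _ ->]; rewrite /root hornerD hornerN hornerC.
  by rewrite -(pa _ (leq_addr _ _)) subrr.
- by rewrite map_inj_uniq ?iota_uniq // => i j /eqP; rewrite eqr_nat eqn_add2l => /eqP.
- by rewrite size_map size_iota.
Qed.

(** The Hilbert function is eventually the constant [#|Z|], which forces dimension 0 and leading
    coefficient [#|Z|] for nonempty [Z]. The empty [Z] is the case $J=S$ of [is_degree]. *)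
Lemma degree_vanishing_ideal Z : degree (vanishing_ideal Z) = #|Z|%:R.
Proof.
pose d0 := (\max_(P in Z) msize (indicator P))%N.
have HZ d : (d0 <= d)%N -> affine_hilbert (vanishing_ideal Z) d = #|Z|.
  by move=> dd; apply: affine_hilbert_vanishing; apply: leqW.
apply: xget_unique => [|e [[ZT ->]|[nZT [k [p [_ sp [d1 pd] ->]]]]]].
- have [Z0|Z0] := eqVneq Z finset.set0.
    by left; split; [apply/vanishing_ideal_setT | rewrite Z0 cards0].
  right; split; first by move=> /vanishing_ideal_setT/eqP; apply/negP.
  exists 0%N, #|Z|%:R%:P; split.
  + exact: vanishing_ideal_krull_dim.
  + by rewrite size_polyC pnatr_eq0 cards_eq0 Z0.
  + by exists d0 => d /HZ ->; rewrite hornerC.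
  + by rewrite lead_coefC mul1r.
- by move/vanishing_ideal_setT: ZT => ->; rewrite cards0.
- have pE : p = #|Z|%:R%:P.
    apply: (@poly_eventually_const _ _ (maxn d0 d1)) => d.
    by rewrite geq_max => /andP[/HZ <- /pd].
  have k0 : k = 0%N.
    by apply/eqP; have := size_polyC_leq1 (#|Z|%:R : rat); rewrite -pE sp ltnS leqn0.
  by rewrite pE lead_coefC k0 mul1r.
Qed.

End VanishingIdeal.

(** * Supports of subcodes and injectivity of squarefree evaluation *)

Section SquarefreeCode.

Variables (K : finFieldType) (s : nat).
Local Notation S := {mpoly K[s]}.
Local Notation point := {ffun 'I_s -> K}.
Implicit Types (P Q : point) (T Z : {set point}) (f g : S).

(** A coordinate vanishes on a span as soon as it vanishes on the generators, so the complement of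
    the support indexes the common zeros. *)
Lemma card_chi_zeros T (F : seq S) :
  (#|chi <<[seq ev T g | g <- F]>>| + #|zeros T [set` F]| = #|T|)%N.
Proof.
set D := <<_>>%VS.
suff -> : zeros T [set` F] = [set enum_val i | i in ~: chi D]%SET.
  by rewrite (card_imset _ enum_val_inj) cardsC card_ord.
have chiPn (i : 'I_#|T|) :
    reflect (forall g, g \in F -> g.@[(enum_val i : point)] = 0) (i \in ~: chi D).
  rewrite !inE negb_exists; apply: (iffP forallP) => [D0 g gF|F0 a].
    have := D0 (ev T g); rewrite mxE negb_and negbK => /orP[/negP[]|/eqP//].
    by apply/memv_span/map_f.
  apply/negP => /andP[aD /eqP]; apply.
  have {aD} := @coord_span _ _ _ (in_tuple [seq ev T g | g <- F]) a aD.
  move=> ->; rewrite summxE big1 // => j _; rewrite mxE.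
  have /mapP[g gF ->] := mem_nth 0 (ltn_ord j).
  by rewrite mxE F0 ?mulr0.
apply/setP => P; apply/idP/imsetP => [|[i /chiPn iF ->]].
  rewrite inE => /andP[PT /asboolP PF].
  exists (enum_rank_in PT P); last by rewrite enum_rankK_in.
  by apply/chiPn => g gF; rewrite enum_rankK_in //; apply: PF.
by rewrite inE enum_valP; apply/asboolP => g; apply: iF.
Qed.

Lemma sqfree_span_comb d k (c : 'I_k -> K) (b : 'I_k -> S) :
  (forall i, sqfree_span d (b i)) -> sqfree_span d (\sum_i c i *: b i).
Proof.
move=> bd; elim/big_ind: _ => [|f g [cf ->] [cg ->]|i _].
- by exists (fun=> 0); rewrite big1 // => m _; rewrite scale0r.
- exists (fun m => cf m + cg m); rewrite -big_split /=.
  by apply: eq_bigr => m _; rewrite scalerDl.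
- have [cb ->] := bd i; exists (fun m => c i * cb m).
  by rewrite scaler_sumr; apply: eq_bigr => m _; rewrite scalerA.
Qed.

(** This places initial monomials in a finite type, where they can be counted. *)
Lemma msupp_sqfree_span d f m : sqfree_span d f -> m \in msupp f ->
  exists m' : 'X_{1..s < d.+1}, m = val m'.
Proof.
case=> c ->; rewrite mcoeff_msupp => fm; apply: contrapT => nom.
case/eqP: fm; rewrite raddf_sum big1 //= => m' _; rewrite mcoeffZ mcoeffX.
by case: eqP => [m'm|]; [case: nom; exists m' | rewrite mulr0].
Qed.

(* Squarefree polynomials are already determined by their values on {1, a}^s
   for any a other than 0, 1: the weights w invert the Vandermonde matrix
   of (1, a) in each coordinate. *)
Lemma sqfree_ev_inj d f : (3 <= #|K|)%N ->
  sqfree_span d f -> ev (torus K s) f = 0 -> f = 0.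
Proof.
move=> K3 [c fE] /ev_eq0 f0.
(* The hypothesis $q\geq 3$ supplies a second nonzero value [a]. *)
have [a] : exists a : K, a \notin [:: 0; 1].
  apply/existsP; apply: contraLR K3; rewrite negb_exists -ltnNge ltnS => /forallP K2.
  apply: leq_trans (card_size [:: 0 : K; 1]); apply/subset_leq_card/fintype.subsetP => x _.
  by rewrite -[_ \in _]negbK.
rewrite !inE negb_or => /andP[a0 a1].
pose u := (a - 1)^-1; have uK : a * u - u = 1.
  by rewrite -{2}[u]mul1r -mulrBl divff // subr_eq0.
pose w (j : nat) (b : bool) : K :=
  if j == 0%N then if b then - u else a * u else if b then u else - u.
pose e (b : bool) : K := if b then a else 1.
have wE i j : (i <= 1)%N -> (j <= 1)%N ->
    \sum_b w j b * e b ^+ i = (i == j)%:R.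
  rewrite big_bool; case: i j => [|[|//]] [|[|//]] _ _ /=; rewrite /w /e /=.
  - by rewrite !mulr1 addrC.
  - by rewrite !mulr1 subrr.
  - by rewrite mulr1 mulNr mulrC addNr.
  - by rewrite mulr1 mulrC.
pose pt (b : {ffun 'I_s -> bool}) : point := [ffun i => e (b i)].
have ptT b : pt b \in torus K s.
  by rewrite inE; apply/forallP => i; rewrite ffunE /e; case: ifP; rewrite ?oner_eq0.
rewrite fE big1 // => m mV; suff -> : c m = 0 by rewrite scale0r.
(* Product weights extract [c m] from the values of [f]: after exchanging sums, the sum over [b]
   factors coordinatewise into Kronecker deltas. *)
have <- : \sum_(b : {ffun 'I_s -> bool}) (\prod_i w (m i) (b i)) * f.@[pt b] = 0.
  by rewrite big1 // => b _; rewrite f0 ?mulr0.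
have fptE b : f.@[pt b] = \sum_(m' in sqfree s d) c m' * \prod_i e (b i) ^+ m' i.
  rewrite fE meval_sum; apply: eq_bigr => m' _; rewrite mevalZ mevalX.
  by congr (_ * _); apply: eq_bigr => i _; rewrite ffunE.
transitivity (\sum_(m' in sqfree s d) c m' * (m' == m)%:R).
  rewrite (bigD1 m) //= eqxx mulr1 big1 ?addr0 // => m' /andP[_ m'm].
  by rewrite (negbTE m'm) mulr0.
under [RHS]eq_bigr => b _ do rewrite fptE mulr_sumr.
rewrite exchange_big; apply: eq_bigr => m' m'V.
under [RHS]eq_bigr => b _ do rewrite mulrCA -big_split.
rewrite -mulr_sumr; congr (_ * _).
rewrite -(bigA_distr_bigA (fun i b => w (m i) b * e b ^+ m' i)) /=.
move: mV m'V; rewrite !inE => /forallP mV /forallP m'V.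
under [RHS]eq_bigr => i _ do rewrite wE //.
have [->|m'm] := eqVneq m' m; first by rewrite big1 // => i _; rewrite eqxx.
have [i mi] : exists i, m' i != m i.
  apply/existsP; apply: contraR m'm; rewrite negb_exists => /forallP mm.
  by apply/eqP/val_inj/mnmP => i; apply/eqP; rewrite -[_ == _]negbK.
by rewrite (bigD1 i) //= (negbTE mi) mul0r.
Qed.

(** * Initial monomials, linear independence and normalised families *)

Section InitialMonomials.

Variables (le : rel 'X_{1..s}).
Hypothesis leM : monomial_order le.

Lemma inm_max f : f != 0 ->
  inm le f \in msupp f /\ {in msupp f, forall m, le m (inm le f)}.
Proof.
have [[le_refl _ le_trans le_total] _] := leM.
rewrite -msupp_eq0 -size_eq0 -(size_sort le) -lt0n => f0.
rewrite /inm -nth_last; split.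
  by rewrite -(mem_sort le) mem_nth // prednK.
move=> m; rewrite -(mem_sort le) => mf; rewrite -{1}(nth_index 0%MM mf).
apply: sorted_leq_nth => //; first exact: sort_sorted.
- by rewrite inE index_mem.
- by rewrite inE prednK.
- by rewrite -ltnS prednK // index_mem.
Qed.

Lemma inmZ (c : K) f : c != 0 -> inm le (c *: f) = inm le f.
Proof.
move=> c0; have [[_ le_anti _ _] _] := leM.
have [->|f0] := eqVneq f 0; first by rewrite scaler0.
have cf0 : c *: f != 0 by rewrite scaler_eq0 negb_or c0.
have [inf lef] := inm_max f0; have [incf lecf] := inm_max cf0.
have cfE : msupp (c *: f) =i msupp f.
  by move=> m; rewrite !mcoeff_msupp mcoeffZ mulf_eq0 (negbTE c0).
by apply: le_anti; rewrite lef -?cfE // lecf // cfE.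
Qed.

(** Among the terms with nonzero coefficient, the largest initial monomial occurs in one term only
    and cannot cancel. *)
Lemma inm_free k (f : 'I_k -> S) (c : 'I_k -> K) :
  (forall i, f i != 0) -> injective (fun i => inm le (f i)) ->
  \sum_i c i *: f i = 0 -> forall i, c i = 0.
Proof.
move=> f0 f_inj cf0 i0; apply/eqP/negPn/negP => ci0.
have [[le_refl le_anti le_trans le_total] _] := leM.
(* The order is reversed because [extremumP] yields a least element. *)
have ge_refl : reflexive (fun m m' => le m' m) by move=> m; apply: le_refl.
have ge_trans : transitive (fun m m' => le m' m).
  by move=> m m' m'' mm' m''m; apply: le_trans m''m mm'.
have ge_total : total (fun m m' => le m' m) by move=> m m'; apply: le_total.
case: (@extremumP _ _ _ i0 (fun i => c i != 0) (fun i => inm le (f i))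
  ge_refl ge_trans ge_total ci0) => i ci imax.
have := congr1 (mcoeff (inm le (f i))) cf0.
rewrite mcoeff0 raddf_sum (bigD1 i) //= big1 => [|j ji].
  rewrite addr0 mcoeffZ => /eqP; rewrite mulf_eq0 (negbTE ci) /=; apply/negP.
  by rewrite -mcoeff_msupp; case: (inm_max (f0 i)).
have [->|cj] := eqVneq (c j) 0; first by rewrite scale0r mcoeff0.
rewrite mcoeffZ memN_msupp_eq0 ?mulr0 //; apply/negP => fij.
case/eqP: ji; apply: f_inj; apply: le_anti.
by rewrite imax //=; case: (inm_max (f0 j)) => _; apply.
Qed.

(* The map D -> K^M recording the coefficients at the set M of initial
   monomials of polynomials evaluating into D is injective, so #|M| >= dim D. *)
Lemma sqfree_subcode_Hset T d (D : {vspace 'rV[K]_#|T|}) :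
  (D <= sqfree_code T d)%VS ->
  exists f : (\dim D).-tuple S,
    Hset le d (\dim D) [set` f] /\ {in f, forall g, ev T g \in D}.
Proof.
move=> DC; have [[le_refl le_anti le_trans le_total] _] := leM.
pose R (m : 'X_{1..s < d.+1}) g :=
  [/\ sqfree_span d g, g != 0, ev T g \in D & inm le g = val m].
pose M : {set 'X_{1..s < d.+1}} := finset (fun m => `[< exists g, R m g >]).
have gP (i : 'I_(\dim D)) : exists g, sqfree_span d g /\ ev T g = (vbasis D)`_i.
  have : [set v | v \in sqfree_code T d] (vbasis D)`_i.
    by apply/(subvP DC)/vbasis_mem/mem_nth; rewrite size_tuple.
  by rewrite sqfree_codeP => -[g gd <-]; exists g.
have {gP} [g gP] := choice gP.
pose A : 'M_(\dim D, #|M|) := \matrix_(i, j) (g i)@_(val (enum_val j)).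
have Afree : row_free A.
  apply: inj_row_free => v vA0; pose f := \sum_i v 0 i *: g i.
  have fd : sqfree_span d f by apply: sqfree_span_comb => i; case: (gP i).
  have evf : ev T f = \sum_i v 0 i *: (vbasis D)`_i.
    by rewrite ev_comb; apply: eq_bigr => i _; case: (gP i) => _ ->.
  (* A nonzero [f] would have its initial monomial in [M], but its coefficient there is an entry of
     [v *m A], which is 0. *)
  have f0 : f = 0.
    apply/eqP/negPn/negP => f0; have [inf _] := inm_max f0.
    have [m mE] := msupp_sqfree_span fd inf.
    have mM : m \in M.
      rewrite inE; apply/asboolP; exists f; split=> //; rewrite evf.
      by apply: memv_suml => i _; apply/memvZ/vbasis_mem/mem_nth; rewrite size_tuple.
    have /rowP/(_ (enum_rank_in mM m)) := vA0.
    rewrite !mxE; apply/eqP.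
    under eq_bigr => i _ do rewrite mxE enum_rankK_in // -mcoeffZ.
    by rewrite -raddf_sum -mE -mcoeff_msupp.
  apply/rowP => i; rewrite mxE.
  have /freeP/(_ (fun i => v 0 i)) := basis_free (vbasisP D); apply.
  by rewrite -evf f0; apply/rowP => j; rewrite !mxE meval0.
have DM : (\dim D <= #|M|)%N by rewrite -(eqP Afree) rank_leq_col.
have hP m : exists h, m \in M -> R m h /\ monic_for le h.
  have [|_] := boolP (m \in M); last by exists 0.
  rewrite inE => /asboolP[h [hd h0 hD hm]].
  have [inh _] := inm_max h0; move: inh; rewrite mcoeff_msupp => ch0.
  have cV0 : (h@_(inm le h))^-1 != 0 by rewrite invr_eq0.
  exists ((h@_(inm le h))^-1 *: h) => _; rewrite /R /monic_for inmZ //.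
  split; last by rewrite mcoeffZ mulVf.
  split=> //.
  - have := @sqfree_span_comb d 1 (fun=> (h@_(inm le h))^-1) (fun=> h) (fun=> hd).
    by rewrite big_ord1.
  - by rewrite scaler_eq0 negb_or cV0.
  - suff -> : ev T ((h@_(inm le h))^-1 *: h) = (h@_(inm le h))^-1 *: ev T h by apply: memvZ.
    by apply/rowP => i; rewrite !mxE mevalZ.
have {hP} [h hP] := choice hP.
(* [M] is only known to have at least [\dim D] elements, so it is truncated. *)
have size_t : size [seq h m | m <- take (\dim D) (enum M)] == \dim D.
  by rewrite size_map size_takel // -cardE.
have tP p : p \in take (\dim D) (enum M) -> R p (h p) /\ monic_for le (h p).
  by move=> /mem_take; rewrite mem_enum => /hP.
exists (Tuple size_t); split; last first.
  by move=> _ /mapP[m /tP[[_ _ hD _] _] ->].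
exists (Tuple size_t); split=> // [_ /mapP[m /tP[[hd h0 _ _] hm] ->]|].
  by split=> //; apply/eqP.
rewrite -map_comp; have /eq_in_map -> : {in take (\dim D) (enum M),
  (fun g => inm le g) \o h =1 val} by move=> m /tP[[]].
by rewrite (map_inj_uniq val_inj) take_uniq ?enum_uniq.
Qed.

End InitialMonomials.

(** Distinct initial monomials make the polynomials independent, and [sqfree_ev_inj] carries the
    independence over to their evaluations. *)
Lemma Hset_subcode (le : rel 'X_{1..s}) d r (F : set S) :
  (3 <= #|K|)%N -> monomial_order le -> Hset le d r F ->
  exists f : r.-tuple S, [/\ F = [set` f],
    (<<[seq ev (torus K s) g | g <- f]>> <= sqfree_code (torus K s) d)%VS
    & \dim <<[seq ev (torus K s) g | g <- f]>> = r].
Proof.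
move=> K3 leM [f [FE fP f_uniq]]; exists f; split=> //.
  apply/span_subvP => _ /mapP[g /fP[gd _ _] ->].
  have : [set v | v \in sqfree_code (torus K s) d] (ev (torus K s) g).
    by rewrite sqfree_codeP; exists g.
  by [].
have nthf (i : 'I_r) : f`_i \in tval f by rewrite mem_nth ?size_tuple.
suff /eqP -> : free [tuple of [seq ev (torus K s) g | g <- f]].
  by rewrite size_tuple.
apply/freeP => c c0; apply: (@inm_free le leM _ (fun i => f`_i)).
- by move=> i; apply/eqP; case: (fP _ (nthf i)).
- move=> i j /eqP ij; apply/val_inj/eqP.
  rewrite -(nth_uniq 0%MM _ _ f_uniq) ?size_map ?size_tuple ?ltn_ord //.
  by rewrite !(nth_map 0) ?size_tuple ?ltn_ord.
apply: (@sqfree_ev_inj d) => //.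
  by apply: sqfree_span_comb => i; case: (fP _ (nthf i)).
rewrite ev_comb -[RHS]c0; apply: eq_bigr => i _.
by rewrite (nth_map 0) ?size_tuple.
Qed.

End SquarefreeCode.

(** * Generalized Hamming weights as complements of maximal degrees *)

Theorem corollary5p3 (K : finFieldType) (s : nat) (le : rel 'X_{1..s})
    (d r : nat) :
  let T := torus K s in
  let I := vanishing_ideal T in
  (3 <= #|K|)%N ->
  graded_monomial_order le ->
  (1 <= d)%N ->
  (1 <= r <= \dim (sqfree_code T d))%N ->
  exists2 M : rat,
    is_max [set degree (ideal_gen (I `|` F)) | F in Hset le d r] M &
    (ghw (sqfree_code T d) r)%:R = #|T|%:R - M.
Proof.
move=> T I K3 [leM _] _ /andP[_ rC].
have [[D [DC Dr wE]] wmin] := ghwP rC.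
set C := sqfree_code T d in DC rC wE wmin *.
exists (#|T|%:R - (ghw C r)%:R); last by rewrite opprB addrC subrK.
have degE (f : seq {mpoly K[s]}) :
    degree (ideal_gen (I `|` [set` f])) =
    #|T|%:R - #|chi <<[seq ev T g | g <- f]>>|%:R.
  rewrite ideal_gen_vanishing degree_vanishing_ideal.
  by apply/esym/eqP; rewrite subr_eq -natrD eqr_nat addnC card_chi_zeros.
(* Upper bound first: each [F] spans an [r]-dimensional subcode, whose support is at least the
   minimum. *)
split=> [|_ [F /(Hset_subcode K3 leM)[f [-> fC fr]] <-]]; last first.
  rewrite degE lerD2l lerN2 ler_nat.
  by apply: wmin; exists <<[seq ev T g | g <- f]>>%VS.
(* The maximum is attained at a family evaluating into the optimal [D]. Its evaluations span a
   subspace of [D] of the same dimension [r], hence [D] itself; [f'] is another enumeration of the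
   same set. *)
have [f [fH fD]] := sqfree_subcode_Hset leM DC; rewrite Dr in f fH fD.
have [f' [ff' _ dimf']] := Hset_subcode K3 leM fH.
exists [set` f] => //; rewrite ff' degE wE; congr (_ - #|chi _|%:R).
apply/eqP; rewrite eqEdim dimf' Dr leqnn andbT.
apply/span_subvP => _ /mapP[g gf' ->]; apply: fD.
by have : [set` f'] g by []; rewrite -ff'.
Qed.
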